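(* Let $\mathcal{E}$ be an extriangulated category and $C\subseteq as(\mathcal{E})$ a subset. For an ultrafilter $\mathcal{U}$ on (the underlying set of) $Esp_C(\mathcal{E})$ put $\mathcal{P}_{\mathcal{U}}:=\{E\in\mathcal{E}: U_C(E)\in\mathcal{U}\}$. If $\mathcal{P}_{\mathcal{U}}\in C$ for every ultrafilter $\mathcal{U}$ on $Esp_C(\mathcal{E})$, then the space $Esp_C(\mathcal{E})$ is spectral. In particular, $Esp_{as(\mathcal{E})}(\mathcal{E})$ and $Esp_{Th(\mathcal{E})}(\mathcal{E})$ are always spectral.
   Context: $\mathcal{E}$ is an extriangulated category (Nakaoka–Palu), with its class of conflations $L\to M\to N$. $as(\mathcal{E})$ denotes the collection of non-empty full subcategories of $\mathcal{E}$ closed under finite direct sums and direct summands (hence containing $0$). $Th(\mathcal{E})\subseteq as(\mathcal{E})$ is the collection of thick subcategories: non-empty full additive subcategories closed under direct summands and with the 2-out-of-3 property for conflations. For $C\subseteq as(\mathcal{E})$ and a class $\mathcal{X}$ of objects put $Z_C(\mathcal{X})=\{\mathcal{P}\in C:\mathcal{P}\cap\mathcal{X}=\emptyset\}$ and $U_C(\mathcal{X})=C\setminus Z_C(\mathcal{X})$. The sets $Z_C(\mathcal{X})$ are the closed sets of a topology on $C$; the resulting space is $Esp_C(\mathcal{E})$. For an object $E$, $U_C(E):=U_C(\{E\})=\{\mathcal{P}\in C: E\in\mathcal{P}\}$. A topological space is spectral if it is homeomorphic to the prime spectrum of a commutative ring. *)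

(* Defs.v *)
From HB Require Import structures.
From mathcomp Require Import all_boot all_algebra.
From mathcomp Require Import all_classical topology_structure.
Set Implicit Arguments.
Unset Strict Implicit.
Unset Printing Implicit Defensive.
Import GRing.Theory.
Local Open Scope classical_set_scope.
Local Open Scope ring_scope.

(** * Additive categories *)

Declare Scope cat_scope.
Delimit Scope cat_scope with cat.
Local Open Scope cat_scope.

Record preadditive_category : Type := PreadditiveCategory {
  obj :> Type;
  hom : obj -> obj -> zmodType;
  idm : forall A, hom A A;
  comp : forall A B C, hom B C -> hom A B -> hom A C;
  compA : forall A B C D (h : hom C D) (g : hom B C) (f : hom A B),
    comp h (comp g f) = comp (comp h g) f;
  comp1m : forall A B (f : hom A B), comp (idm B) f = f;
  compm1 : forall A B (f : hom A B), comp f (idm A) = f;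
  compDl : forall A B C (g g' : hom B C) (f : hom A B),
    comp (g + g') f = comp g f + comp g' f;
  compDr : forall A B C (g : hom B C) (f f' : hom A B),
    comp g (f + f') = comp g f + comp g f'
}.

Notation "g \oc f" := (comp g f)
  (at level 40, left associativity) : cat_scope.

Section Preadditive.
Variable E : preadditive_category.

Definition is_zero_object (Z : E) : Prop :=
  (forall (A : E) (f : hom A Z), f = 0) /\ (forall (A : E) (f : hom Z A), f = 0).

Definition is_iso (A B : E) (f : hom A B) : Prop :=
  exists2 g : hom B A, g \oc f = idm A & f \oc g = idm B.

Record is_biproduct (A B S : E) (iA : hom A S) (iB : hom B S)
    (pA : hom S A) (pB : hom S B) : Prop := IsBiproduct {
  biproduct_AA : pA \oc iA = idm A;
  biproduct_BB : pB \oc iB = idm B;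
  biproduct_AB : pA \oc iB = 0;
  biproduct_BA : pB \oc iA = 0;
  biproduct_id : iA \oc pA + iB \oc pB = idm S
}.

(* S is isomorphic to the direct sum of A and B *)
Definition is_direct_sum (A B S : E) : Prop :=
  exists (iA : hom A S) (iB : hom B S) (pA : hom S A) (pB : hom S B),
    is_biproduct iA iB pA pB.

End Preadditive.

Record additive_category : Type := AdditiveCategory {
  additive_base :> preadditive_category;
  has_zero_object : exists Z : additive_base, is_zero_object Z;
  has_direct_sums : forall A B : additive_base, exists S, is_direct_sum A B S
}.

(** * Extriangulated categories (Nakaoka-Palu) *)

(* Additive bifunctors E^op * E -> Ab. An element of [ext C A] is an extension
   of C by A; [push a d] and [pull c d] are a_* d and c^* d. *)
Record additive_bifunctor (E : additive_category) : Type := AdditiveBifunctor {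
  ext : E -> E -> zmodType;
  push : forall C A A' : E, hom A A' -> ext C A -> ext C A';
  pull : forall C C' A : E, hom C' C -> ext C A -> ext C' A;
  push1 : forall (C A : E) (d : ext C A), push (idm A) d = d;
  push_comp : forall (C A A' A'' : E) (a' : hom A' A'') (a : hom A A')
    (d : ext C A), push (a' \oc a) d = push a' (push a d);
  pull1 : forall (C A : E) (d : ext C A), pull (idm C) d = d;
  pull_comp : forall (C C' C'' A : E) (c : hom C' C) (c' : hom C'' C')
    (d : ext C A), pull (c \oc c') d = pull c' (pull c d);
  push_pull : forall (C C' A A' : E) (a : hom A A') (c : hom C' C)
    (d : ext C A), push a (pull c d) = pull c (push a d);
  pushD : forall (C A A' : E) (a : hom A A') (d d' : ext C A),
    push a (d + d') = push a d + push a d';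
  pullD : forall (C C' A : E) (c : hom C' C) (d d' : ext C A),
    pull c (d + d') = pull c d + pull c d';
  push_addm : forall (C A A' : E) (a a' : hom A A') (d : ext C A),
    push (a + a') d = push a d + push a' d;
  pull_addm : forall (C C' A : E) (c c' : hom C' C) (d : ext C A),
    pull (c + c') d = pull c d + pull c' d
}.

Section Realization.
Variables (E : additive_category) (EE : additive_bifunctor E).

Definition ext_morphism (A C A' C' : E) (d : ext EE C A) (d' : ext EE C' A')
    (a : hom A A') (c : hom C C') : Prop :=
  push a d = pull c d'.

(* Equivalence of the sequences A -x-> B -y-> C and A -x'-> B' -y'-> C. *)
Definition seq_equiv (A C B B' : E) (x : hom A B) (y : hom B C)
    (x' : hom A B') (y' : hom B' C) : Prop :=
  exists b : hom B B', [/\ is_iso b, b \oc x = x' & y' \oc b = y].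

(* [s x y d] says that the sequence A -x-> B -y-> C belongs to s(d). *)
Variable s : forall A B C : E, hom A B -> hom B C -> ext EE C A -> Prop.

(* The first two fields say that s(d) is an equivalence class of sequences. *)
Record is_realization : Prop := IsRealization {
  realization_ex : forall (A C : E) (d : ext EE C A),
    exists (B : E) (x : hom A B) (y : hom B C), s x y d;
  realization_class : forall (A C B B' : E) (d : ext EE C A)
    (x : hom A B) (y : hom B C) (x' : hom A B') (y' : hom B' C),
    s x y d -> (s x' y' d <-> seq_equiv x y x' y');
  realization_mor : forall (A B C A' B' C' : E)
    (d : ext EE C A) (d' : ext EE C' A')
    (x : hom A B) (y : hom B C) (x' : hom A' B') (y' : hom B' C')
    (a : hom A A') (c : hom C C'),
    s x y d -> s x' y' d' -> ext_morphism d d' a c ->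
    exists2 b : hom B B', b \oc x = x' \oc a & y' \oc b = c \oc y
}.

(* In [realization_sum], the sequence is SA -(x (+) x')-> SB -(y (+) y')-> SC and
   the extension is d (+) d', the element of ext SC SA that corresponds to
   (d, 0, 0, d') under additivity of ext. *)
Record is_additive_realization : Prop := IsAdditiveRealization {
  realization_base : is_realization;
  realization_split : forall (A C S : E) (iA : hom A S) (iC : hom C S)
    (pA : hom S A) (pC : hom S C), is_biproduct iA iC pA pC ->
    s iA pC (0 : ext EE C A);
  realization_sum : forall (A B C A' B' C' : E)
    (d : ext EE C A) (d' : ext EE C' A')
    (x : hom A B) (y : hom B C) (x' : hom A' B') (y' : hom B' C')
    (SA SB SC : E)
    (iA : hom A SA) (iA' : hom A' SA) (pA : hom SA A) (pA' : hom SA A')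
    (iB : hom B SB) (iB' : hom B' SB) (pB : hom SB B) (pB' : hom SB B')
    (iC : hom C SC) (iC' : hom C' SC) (pC : hom SC C) (pC' : hom SC C'),
    is_biproduct iA iA' pA pA' -> is_biproduct iB iB' pB pB' ->
    is_biproduct iC iC' pC pC' ->
    s x y d -> s x' y' d' ->
    s (iB \oc x \oc pA + iB' \oc x' \oc pA')
      (iC \oc y \oc pB + iC' \oc y' \oc pB')
      (push iA (pull pC d) + push iA' (pull pC' d'))
}.

Definition ET3 : Prop :=
  forall (A B C A' B' C' : E) (d : ext EE C A) (d' : ext EE C' A')
    (x : hom A B) (y : hom B C) (x' : hom A' B') (y' : hom B' C')
    (a : hom A A') (b : hom B B'),
  s x y d -> s x' y' d' -> b \oc x = x' \oc a ->
  exists2 c : hom C C', c \oc y = y' \oc b & ext_morphism d d' a c.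

Definition ET3op : Prop :=
  forall (A B C A' B' C' : E) (d : ext EE C A) (d' : ext EE C' A')
    (x : hom A B) (y : hom B C) (x' : hom A' B') (y' : hom B' C')
    (b : hom B B') (c : hom C C'),
  s x y d -> s x' y' d' -> c \oc y = y' \oc b ->
  exists2 a : hom A A', b \oc x = x' \oc a & ext_morphism d d' a c.

(*    A -f-> B -f'-> D
      =      |g      |u
      A -h-> C -h'-> G
             |g'     |v
             F   =   F      *)
Definition ET4 : Prop :=
  forall (A B C D F : E) (d : ext EE D A) (d' : ext EE F B)
    (f : hom A B) (f' : hom B D) (g : hom B C) (g' : hom C F),
  s f f' d -> s g g' d' ->
  exists (G : E) (u : hom D G) (v : hom G F) (h : hom A C) (h' : hom C G)
    (d'' : ext EE G A),
  [/\ h = g \oc f, h' \oc g = u \oc f' & g' = v \oc h'] /\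
  [/\ s h h' d'', s u v (push f' d'), pull u d'' = d &
      push f d'' = pull v d'].

(*    D -u-> G -v-> F
      =      |h'    |g'
      D -f'> A -f-> B
             |h     |g
             C  =   C       *)
Definition ET4op : Prop :=
  forall (A B C D F : E) (d : ext EE B D) (d' : ext EE C F)
    (f' : hom D A) (f : hom A B) (g' : hom F B) (g : hom B C),
  s f' f d -> s g' g d' ->
  exists (G : E) (u : hom D G) (v : hom G F) (h' : hom G A) (h : hom A C)
    (d'' : ext EE C G),
  [/\ f' = h' \oc u, f \oc h' = g' \oc v & h = g \oc f] /\
  [/\ s h' h d'', s u v (pull g' d), d' = push v d'' &
      push u d = pull g d''].

End Realization.

Record extriangulated_category : Type := ExtriangulatedCategory {
  extri_base :> additive_category;
  extri_ext : additive_bifunctor extri_base;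
  extri_rlz : forall A B C : extri_base,
    hom A B -> hom B C -> ext extri_ext C A -> Prop;
  extri_additive : is_additive_realization extri_rlz;
  extri_ET3 : ET3 extri_rlz;
  extri_ET3op : ET3op extri_rlz;
  extri_ET4 : ET4 extri_rlz;
  extri_ET4op : ET4op extri_rlz
}.

Definition is_conflation (E : extriangulated_category) (L M N : E)
    (x : hom L M) (y : hom M N) : Prop :=
  exists d : ext (extri_ext E) N L, extri_rlz x y d.

(** * Subcategories: a full subcategory is given by its set of objects *)

(* The empty direct sum is covered: a zero object Z is a direct summand of any
   object A, since A is a direct sum of A and Z. Likewise, closure under
   isomorphism follows from closure under direct summands. *)
Definition as_subcat (E : extriangulated_category) : set (set E) :=
  [set P | [/\ P !=set0,
    (forall A B S : E, is_direct_sum A B S -> P A -> P B -> P S) &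
    (forall A B S : E, is_direct_sum A B S -> P S -> P A /\ P B)]].
Arguments as_subcat : clear implicits.

Definition two_out_of_three (E : extriangulated_category) (P : set E) : Prop :=
  forall (L M N : E) (x : hom L M) (y : hom M N), is_conflation x y ->
  [/\ P L -> P M -> P N, P L -> P N -> P M & P M -> P N -> P L].

Definition thick_subcat (E : extriangulated_category) : set (set E) :=
  [set P | as_subcat E P /\ two_out_of_three P].
Arguments thick_subcat : clear implicits.

Lemma thick_as (E : extriangulated_category) :
  thick_subcat E `<=` as_subcat E.
Proof. by move=> P []. Qed.

(** * The space Esp_C(E) *)

Definition Esp (E : extriangulated_category) (C : set (set E))
  (hC : C `<=` as_subcat E) : Type := set_type C.

Section EspTopology.
Variables (E : extriangulated_category) (C : set (set E)).
Variable hC : C `<=` as_subcat E.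

HB.instance Definition _ := Choice.copy (Esp hC) (set_type C).

Definition ZC (X : set E) : set (Esp hC) := [set P | val P `&` X = set0].
Definition UC (X : set E) : set (Esp hC) := ~` ZC X.

Definition Esp_open : set_system (Esp hC) := [set O | exists X, O = UC X].

Lemma UCE (X : set E) (P : Esp hC) : UC X P <-> val P `&` X !=set0.
Proof. by split=> [/eqP/set0P|/set0P/eqP]. Qed.

Lemma UC1E (A : E) (P : Esp hC) : UC [set A] P <-> (val P : set E) A.
Proof.
by rewrite UCE; split=> [[B [PB /= <-]]|PA] //; exists A.
Qed.

Lemma Esp_as (P : Esp hC) : as_subcat E (val P).
Proof. exact: hC (set_valP P). Qed.

Lemma Esp_openT : Esp_open setT.
Proof.
exists setT; rewrite predeqE => P; split=> // _; apply/UCE.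
by rewrite setIT; case: (Esp_as P).
Qed.

Lemma Esp_openI : setI_closed Esp_open.
Proof.
move=> _ _ [X ->] [Y ->].
exists [set S | exists A B, [/\ X A, Y B & is_direct_sum A B S]].
rewrite predeqE => P; have [_ sumP smdP] := Esp_as P.
split=> [[/UCE[A [PA XA]] /UCE[B [PB YB]]]|/UCE[S [PS [A [B [XA YB SAB]]]]]].
- have [S SAB] := has_direct_sums A B.
  by apply/UCE; exists S; split; [exact: sumP SAB PA PB | exists A, B].
- have [PA PB] := smdP _ _ _ SAB PS.
  by split; apply/UCE; [exists A | exists B].
Qed.

Lemma Esp_open_bigU (I : Type) (f : I -> set (Esp hC)) :
  (forall i, Esp_open (f i)) -> Esp_open (\bigcup_i f i).
Proof.
move=> fo; exists [set A | exists i X, f i = UC X /\ X A].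
rewrite predeqE => P; split=> [[i _ fiP]|/UCE[A [PA [i [X [fiX XA]]]]]].
- have [X fiX] := fo i; move: fiP; rewrite fiX => /UCE[A [PA XA]].
  by apply/UCE; exists A; split=> //; exists i, X.
- by exists i => //; rewrite fiX; apply/UCE; exists A.
Qed.

HB.instance Definition _ :=
  isOpenTopological.Build (Esp hC) Esp_openT Esp_openI Esp_open_bigU.

Lemma closed_EspE (A : set (Esp hC)) : closed A <-> exists X, A = ZC X.
Proof.
rewrite -openC; split=> [[X AX]|[X ->]]; exists X => //.
by rewrite -[A]setCK AX /UC setCK.
Qed.

End EspTopology.

(** * Prime spectra and spectral spaces *)

(* Commutative rings are allowed to be trivial ([comPzRingType]), so that the
   empty space, which is the spectrum of the zero ring, is spectral. *)
Definition prime_ideal (R : comPzRingType) : set (set R) :=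
  [set p | [/\ p 0,
    (forall x y, p x -> p y -> p (x + y)),
    (forall a x, p x -> p (a * x)),
    ~ p 1 &
    (forall x y, p (x * y) -> p x \/ p y)]].

Definition Spec (R : comPzRingType) : Type := set_type (@prime_ideal R).

Section SpecTopology.
Variable R : comPzRingType.

HB.instance Definition _ := Choice.copy (Spec R) (set_type (@prime_ideal R)).

Definition zero_locus (S : set R) : set (Spec R) := [set p | S `<=` val p].

Definition Zariski_open : set_system (Spec R) :=
  [set O | exists S, O = ~` zero_locus S].

Lemma zero_locusCE (S : set R) (p : Spec R) :
  (~` zero_locus S) p <-> exists2 x, S x & ~ (val p : set R) x.
Proof. by split=> [/existsNP[x /not_implyP[]]|[x Sx px] /(_ x Sx)]; first exists x. Qed.

Lemma Spec_prime (p : Spec R) : prime_ideal (val p).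
Proof. exact: set_valP. Qed.

Lemma Zariski_openT : Zariski_open setT.
Proof.
exists [set 1]; rewrite predeqE => p; split=> // _; apply/zero_locusCE.
by exists 1 => //; case: (Spec_prime p).
Qed.

Lemma Zariski_openI : setI_closed Zariski_open.
Proof.
move=> _ _ [S ->] [T ->].
exists [set z | exists x y, [/\ S x, T y & z = x * y]].
rewrite predeqE => p; have [_ _ pM _ pP] := Spec_prime p.
split=> [[/zero_locusCE[x Sx px] /zero_locusCE[y Ty py]]|].
- apply/zero_locusCE; exists (x * y); first by exists x, y.
  by case/pP.
- move=> /zero_locusCE[_ [x [y [Sx Ty ->]]] pxy].
  split; apply/zero_locusCE; [exists x => // px|exists y => // py]; apply: pxy.
  + by rewrite mulrC; exact: pM.
  + exact: pM.
Qed.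

Lemma Zariski_open_bigU (I : Type) (f : I -> set (Spec R)) :
  (forall i, Zariski_open (f i)) -> Zariski_open (\bigcup_i f i).
Proof.
move=> fo; exists [set x | exists i S, f i = ~` zero_locus S /\ S x].
rewrite predeqE => p; split=> [[i _ fip]|/zero_locusCE[x [i [S [fiS Sx]]] px]].
- have [S fiS] := fo i; move: fip; rewrite fiS => /zero_locusCE[x Sx px].
  by apply/zero_locusCE; exists x => //; exists i, S.
- by exists i => //; rewrite fiS; apply/zero_locusCE; exists x.
Qed.

HB.instance Definition _ :=
  isOpenTopological.Build (Spec R) Zariski_openT Zariski_openI Zariski_open_bigU.

End SpecTopology.

Definition homeomorphic (X Y : topologicalType) : Prop :=
  exists (f : X -> Y) (g : Y -> X),
    [/\ continuous f, continuous g, cancel f g & cancel g f].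

Definition spectral (X : topologicalType) : Prop :=
  exists R : comPzRingType, homeomorphic X (Spec R).

(* Main.v *)
Require Import Defs.
From HB Require Import structures.
From mathcomp Require Import all_boot all_algebra.
From mathcomp Require Import finmap monalg.
From mathcomp Require Import all_classical topology_structure.
Set Implicit Arguments.
Unset Strict Implicit.
Unset Printing Implicit Defensive.
Import GRing.Theory.
Local Open Scope classical_set_scope.
Local Open Scope ring_scope.

(* The ultrafilter hypothesis is the compactness of the constructible topology
   of Esp_C(E), and the sets U_C(A) form a basis stable under intersection, as
   U_C(A (+) B) is the intersection of U_C(A) and U_C(B). Such a space X, with
   basis (U_i), is the spectrum of a ring: a one-step version of Hochster's
   construction. Let K = Q(t_i), and for x in X let K_x be the subfield
   Q(t_i : x in U_i) and v_x the monomial valuation in which t_i has weight 0 if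
   x is in U_i and 1 otherwise. Let R be the ring of the functions f : X -> K
   such that f(x) depends only on the membership of x in finitely many U_i,
   f(x) is in K_x, and v_x(f(y) - f(x)) > 0 whenever x is in the closure of y.
   Write D(f) for the set where f is nonzero.
   - D(f) is constructible and stable under generization, hence open, and U_i is
     D of the function equal to t_i on U_i and to 0 elsewhere.
   - D(b) U D(c) = D(b + n c) for some integer n, since b/c takes finitely many
     values.
   - If D(a) is contained in D(b), then b divides some power of a: v_x(b(y)) is
     bounded because b takes finitely many values, so for large n the function
     a^n/b, extended by 0, is in R.
   So if p is a prime ideal of R, the sets D(a) \ D(b) for a not in p and b in p
   generate a proper filter, and the limit x of an ultrafilter containing it
   satisfies p = { f | f(x) = 0 }. *)

(** * Polynomials in infinitely many variables *)

Section WeightedDegree.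
Variables (I : choiceType) (w : I -> nat).

Definition wdeg (m : {cmonom I}) : nat := (\sum_(i <- finsupp m) m i * w i)%N.

Lemma wdegEw (m : {cmonom I}) (d : {fset I}) : (finsupp m `<=` d)%fset ->
  wdeg m = (\sum_(i <- d) m i * w i)%N.
Proof.
move=> le_md; rewrite /wdeg (big_fset_incl _ le_md) //.
by move=> i _; rewrite -cmE_neq0 negbK => /eqP ->.
Qed.

Lemma wdeg1 : wdeg mone = 0%N.
Proof. by rewrite /wdeg mdom1 big_seq_fset0. Qed.

Lemma wdegU i : wdeg (ucm i) = w i.
Proof. by rewrite /wdeg mdomU big_seq_fset1 cmUU mul1n. Qed.

Lemma wdegM m1 m2 : wdeg (mmul m1 m2) = (wdeg m1 + wdeg m2)%N.
Proof.
rewrite [LHS]/wdeg mdomD (wdegEw (fsubsetUl _ (finsupp m2))).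
rewrite (wdegEw (fsubsetUr (finsupp m1) _)) -big_split.
by apply: eq_bigr => i _; rewrite cmM mulnDl.
Qed.

Lemma wdeg_le_mdeg m : (forall i, w i <= 1)%N -> (wdeg m <= mdeg m)%N.
Proof.
move=> w_le1; apply: leq_sum => i _.
by rewrite -[leqRHS]muln1 leq_mul2l w_le1 orbT.
Qed.

End WeightedDegree.

Lemma wdeg_perturb (I : choiceType) (w : I -> nat) (N : nat) (i : I) m :
  wdeg (fun j => w j * N + (j == i))%N m = (wdeg w m * N + m i)%N.
Proof.
rewrite (wdegEw _ (fsubsetUl (finsupp m) [fset i]%fset)).
rewrite (wdegEw w (fsubsetUl (finsupp m) [fset i]%fset)) big_distrl /=.
under eq_bigr do rewrite mulnDr mulnA.
rewrite big_split /=; congr addn.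
rewrite (big_fsetD1 i) /=; last by rewrite !inE eqxx orbT.
rewrite eqxx muln1 big1_fset ?addn0 // => j.
by rewrite !inE => /andP[/negPf-> _]; rewrite muln0.
Qed.

(** Induction on the list. If a and b differ at i, the exponent of i is appended to the old weighted
    degree as a last digit in base [N]. As [N] exceeds all exponents of i in the list, equal new
    degrees force equal digits and equal old degrees. *)
Lemma wdeg_separates (I : choiceType) (s : seq ({cmonom I} * {cmonom I})) :
  exists w : I -> nat,
    forall p, p \in s -> p.1 != p.2 -> wdeg w p.1 != wdeg w p.2.
Proof.
elim: s => [|[a b] s [w sepw]]; first by exists (fun=> 0%N).
have [->|neq_ab] := eqVneq a b.
  by exists w => p; rewrite inE => /predU1P[->|]; [rewrite eqxx|exact: sepw].
have /existsNP[i /eqP neq_abi] : ~ forall i, a i = b i.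
  by move=> eq_ab; case/negP: neq_ab; apply/cmP.
pose N := (\max_(p <- (a, b) :: s) maxn (p.1 i) (p.2 i)).+1.
exists (fun j => w j * N + (j == i))%N => p sp neq_p.
have [lt1 lt2] : (p.1 i < N)%N /\ (p.2 i < N)%N.
  have := @leq_bigmax_seq _ ((a, b) :: s) xpredT
    (fun p => maxn (p.1 i) (p.2 i)) p sp isT.
  by rewrite geq_max => /andP[].
rewrite !wdeg_perturb; apply/negP => /eqP eq_p.
have eq_mod : p.1 i = p.2 i.
  by have := congr1 (modn^~ N) eq_p; rewrite /= !modnMDl !modn_small.
move: eq_p; rewrite eq_mod => /addIn/eqP; rewrite eqn_pmul2r // => /eqP eq_w.
move: sp; rewrite inE => /predU1P[p_ab|sp].
  by case/negP: neq_abi; apply/eqP; move: eq_mod; rewrite p_ab.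
by have := sepw p sp neq_p; rewrite eq_w eqxx.
Qed.

Definition ratpoly (I : choiceType) := {malg rat[{cmonom I}]}.
HB.instance Definition _ I := GRing.ComNzRing.on (ratpoly I).

Lemma ratpolyUU (I : choiceType) (c d : rat) (m n : {cmonom I}) :
  (<< c *g m >> : ratpoly I) * << d *g n >> = << c * d *g mmul m n >>.
Proof. by have := fgmulUU c d m n; rewrite -malgM_def. Qed.

(** * Absence of zero divisors, by substitution into one variable *)

Section Kronecker.
Variables (I : choiceType) (w : I -> nat).

Definition kron_monom (m : {cmonom I}) : {poly rat} := 'X^(wdeg w m).

Fact kron_monom_mmorphism : mmorphism kron_monom.
Proof.
split=> [m1 m2|]; last by rewrite /kron_monom wdeg1 expr0.
by rewrite /kron_monom wdegM exprD.
Qed.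
HB.instance Definition _ :=
  isMultiplicative.Build _ _ kron_monom kron_monom_mmorphism.

Definition kron : ratpoly I -> {poly rat} := mmap polyC kron_monom.
HB.instance Definition _ := GRing.RMorphism.on kron.

(** Distinct monomials of p land in distinct degrees, so no cancellation occurs and each coefficient
    survives. *)
Lemma kron_neq0 (p : ratpoly I) : p != 0 ->
  {in msupp p &, forall a b, a != b -> wdeg w a != wdeg w b} -> kron p != 0.
Proof.
rewrite -msupp_eq0 => /fset0Pn[m pm] sepw.
apply: contraTneq isT => kp0; have : (kron p)`_(wdeg w m) = 0 by rewrite kp0 coef0.
rewrite coef_sum (big_fsetD1 m) //= big1_fset ?addr0.
  by rewrite coefCM coefXn eqxx mulr1 => /eqP; rewrite mcoeff_eq0 pm.
move=> a; rewrite in_fsetD1 => /andP[neq_am pa] _.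
by rewrite coefCM coefXn eq_sym (negPf (sepw _ _ pa pm neq_am)) mulr0.
Qed.

End Kronecker.

Section RatPolyDomain.
Variable I : choiceType.
Local Notation P := (ratpoly I).

Let punit : {pred P} := fun p => `[<exists q : P, q * p = 1>].
Let pinv (p : P) : P :=
  if pselect (exists q : P, q * p = 1) is left e then projT1 (cid e) else p.

Fact ratpoly_mulVp : {in punit, left_inverse 1 pinv *%R}.
Proof.
move=> p /asboolP up; rewrite /pinv; case: pselect => // e.
by case: (cid e).
Qed.

Fact ratpoly_unitPl (p q : P) : q * p = 1 -> punit p.
Proof. by move=> qp; apply/asboolP; exists q. Qed.

Fact ratpoly_inv_out : {in [predC punit], pinv =1 id}.
Proof.
move=> p; rewrite inE /= => /asboolP up.
by rewrite /pinv; case: pselect.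
Qed.

HB.instance Definition _ := GRing.ComNzRing_hasMulInverse.Build P
  ratpoly_mulVp ratpoly_unitPl ratpoly_inv_out.

(** One weight separates the finitely many monomials of p and q, so [kron] sends both to nonzero
    elements of the domain Q[X]. *)
Fact ratpoly_mulf_eq0 (p q : P) : p * q = 0 -> (p == 0) || (q == 0).
Proof.
move=> pq0; apply/norP => -[p0 q0].
pose ms := enum_fset (msupp p) ++ enum_fset (msupp q).
have [w sepw] := wdeg_separates [seq (a, b) | a <- ms, b <- ms].
have kp : kron w p != 0.
  apply: kron_neq0 => // a b pa pb neq_ab.
  apply: (sepw (a, b)) => //; apply: (allpairs_f pair);
  by rewrite mem_cat ?pa ?pb.
have kq : kron w q != 0.
  apply: kron_neq0 => // a b qa qb neq_ab.
  apply: (sepw (a, b)) => //; apply: (allpairs_f pair);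
  by rewrite mem_cat ?qa ?qb orbT.
by have := mulf_neq0 kp kq; rewrite -rmorphM pq0 rmorph0 eqxx.
Qed.

HB.instance Definition _ := GRing.ComUnitRing_isIntegral.Build P ratpoly_mulf_eq0.

End RatPolyDomain.

(** * Monomial valuations *)

Local Notation "p %:F" := (@FracField.tofrac _ p) : ring_scope.

Lemma Xn_Ndvd_mul (F : fieldType) (m n : nat) (p q : {poly F}) :
  ~~ ('X^(m.+1) %| p) -> ~~ ('X^(n.+1) %| q) -> ~~ ('X^((m + n).+1) %| p * q).
Proof.
have [->|p0] := eqVneq p 0; first by rewrite dvdp0.
have [->|q0] := eqVneq q 0; first by rewrite dvdp0.
rewrite -['X]subr0 -polyC0 -!mup_leq ?mulf_neq0 // mupM // => le_m le_n.
exact: leq_add.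
Qed.

Lemma Xn_dvdP (F : fieldType) (p : {poly F}) : p != 0 ->
  exists2 n, 'X^n %| p & ~~ ('X^(n.+1) %| p).
Proof.
move=> p0; exists (mup 0 p); rewrite -['X]subr0 -polyC0.
  by rewrite -mup_geq.
by rewrite -mup_leq.
Qed.

Lemma fraction_ex (R : idomainType) (g : {fraction R}) :
  exists a b : R, b != 0 /\ g = a%:F / b%:F.
Proof.
elim/quotW: g => r; exists \n_r, \d_r; have d0 := denom_ratioP r; split=> //.
apply: (mulIf (x := (\d_r)%:F)); first by rewrite tofrac_eq0.
rewrite divfK ?tofrac_eq0 //; unlock FracField.tofrac; rewrite -[LHS]FracField.pi_mul.
apply/eqmodP; rewrite /= FracField.equivfE /FracField.mulf /=.
by rewrite !numden_Ratio ?mulf_neq0 ?oner_neq0 ?mulr1 // mulrC.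
Qed.

(* What is used of the polynomial ring in variables t_i ([wvar i]): [wscale w] is
   the substitution t_i |-> t_i X^(w i), and the order of vanishing at X = 0 is
   then the monomial valuation of weight [w]. *)
Record weighted_domain (I : Type) := WeightedDomain {
  wdom :> idomainType;
  wscale : (I -> nat) -> {rmorphism wdom -> {poly {fraction wdom}}};
  wvar : I -> wdom;
  wdom_natr_neq0 : forall n, n.+1%:R != 0 :> wdom;
  wvar_neq0 : forall i, wvar i != 0;
  wscale_eq0 : forall w p, (wscale w p == 0) = (p == 0);
  wscale_var : forall w i, wscale w (wvar i) = ((wvar i)%:F)%:P * 'X^(w i);
  wscale_Ndvd : forall p, p != 0 -> exists N : nat,
    forall w, (forall i, w i <= 1)%N -> ~~ ('X^(N.+1) %| wscale w p)
}.

(** * The substitution t_i |-> t_i X^(w i) *)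

Section Substitution.
Variables (I : choiceType) (w : I -> nat).
Local Notation P := (ratpoly I).
Local Notation K := {fraction P}.

Definition scale_monom (m : {cmonom I}) : {poly K} :=
  ((<< m >> : P)%:F)%:P * 'X^(wdeg w m).

Fact scale_monom_mmorphism : mmorphism scale_monom.
Proof.
split=> [m1 m2|]; last by rewrite /scale_monom wdeg1 expr0 mulr1 tofrac1.
rewrite /scale_monom wdegM exprD mulrACA; congr (_ * _).
by rewrite -polyCM -tofracM ratpolyUU mulr1.
Qed.
HB.instance Definition _ :=
  isMultiplicative.Build _ _ scale_monom scale_monom_mmorphism.

Definition const_ratfun : rat -> {poly K} :=
  polyC \o @FracField.tofrac P \o (malgC : rat -> {malg rat[{cmonom I}]}).
HB.instance Definition _ := GRing.RMorphism.on const_ratfun.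

Definition scale : P -> {poly K} := mmap const_ratfun scale_monom.
HB.instance Definition _ := GRing.RMorphism.on scale.

(** Evaluation at X = 1 undoes the substitution, whence its injectivity. *)
Lemma scale1 p : (scale p).[1] = p%:F.
Proof.
rewrite /scale /mmap horner_sum.
rewrite [in RHS](monalgE p) raddf_sum /=; apply: eq_bigr => m _.
rewrite hornerM [X in _ * X]hornerM [X in _ * (X * _)]hornerC hornerXn expr1n mulr1.
by rewrite [X in X * _]hornerC -tofracM ratpolyUU mulr1 mul1m.
Qed.

Lemma scale_eq0 p : (scale p == 0) = (p == 0).
Proof.
apply/eqP/eqP => [sp0|->]; last exact: rmorph0.
by apply/eqP; rewrite -tofrac_eq0 -scale1 sp0 horner0.
Qed.

Lemma scaleU i : scale << ucm i >> = ((<< ucm i >> : P)%:F)%:P * 'X^(w i).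
Proof.
have c1 : const_ratfun 1 = 1 by exact: (rmorph1 const_ratfun).
transitivity (const_ratfun 1 * scale_monom (ucm i)); first exact: mmapU.
by rewrite c1 [LHS]mul1r /scale_monom wdegU.
Qed.

(** With weights at most 1, the degree in X is at most the total degree of p. The bound is the same
    for all such w, hence later for all points of the space. *)
Lemma scale_Ndvd (p : P) : p != 0 -> (forall i, w i <= 1)%N ->
  ~~ ('X^((\max_(m <- msupp p) mdeg m).+1) %| scale p).
Proof.
move=> p0 w_le1; apply/negP => /dvdp_leq.
rewrite scale_eq0 size_polyXn => /(_ p0); apply/negP; rewrite -leqNgt.
apply: (leq_trans (size_sum _ _ _)); apply/bigmax_leqP_seq => m pm _.
rewrite mulrA -polyCM mul_polyC (leq_trans (size_scale_leq _ _)) // size_polyXn ltnS.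
by rewrite (leq_trans (wdeg_le_mdeg _ w_le1)) // (@leq_bigmax_seq _ _ xpredT mdeg).
Qed.

End Substitution.

Lemma ratpoly_natr_neq0 (I : choiceType) n : n.+1%:R != 0 :> ratpoly I.
Proof.
apply/eqP => /(congr1 (mcoeff mone)); rewrite [RHS]mcoeff0 [LHS]mcoeffMn.
by rewrite [X in X *+ _]mcoeffUU => /eqP; rewrite Num.Theory.pnatr_eq0.
Qed.

Definition ratpoly_wdom (I : choiceType) : weighted_domain I.
Proof.
apply: (@WeightedDomain I (ratpoly I) (fun w => @scale I w) (fun i => << ucm i >>)).
- exact: ratpoly_natr_neq0.
- by move=> i; rewrite monalgU_eq0 oner_eq0.
- exact: scale_eq0.
- exact: scaleU.
- move=> p p0; exists (\max_(m <- msupp p) mdeg m)%N => w; exact: scale_Ndvd.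
Defined.

Section Valuation.
Variables (I : Type) (P : weighted_domain I) (w : I -> nat).
Local Notation K := {fraction P}.
Local Notation phi := (wscale P w).

Definition exact_ord (n : nat) (b : P) : Prop :=
  'X^n %| phi b /\ ~~ ('X^(n.+1) %| phi b).

Lemma exact_ord_neq0 n (b : P) : exact_ord n b -> b != 0.
Proof. by case=> _; apply: contraNneq => ->; rewrite rmorph0 dvdp0. Qed.

Lemma exact_ord_ex (b : P) : b != 0 -> exists n, exact_ord n b.
Proof. by rewrite -(wscale_eq0 w) => /Xn_dvdP[n]; exists n. Qed.

Lemma exact_ordM m n (a b : P) :
  exact_ord m a -> exact_ord n b -> exact_ord (m + n) (a * b).
Proof.
move=> [Xa Na] [Xb Nb]; split; rewrite rmorphM ?Xn_Ndvd_mul //.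
by rewrite exprD dvdp_mul.
Qed.

Lemma exact_ord_const (b : P) : b != 0 -> phi b = (b%:F)%:P -> exact_ord 0 b.
Proof.
move=> b0 phib; split; first by rewrite expr0 dvd1p.
rewrite phib; apply/negP => /dvdp_leq; rewrite polyC_eq0 tofrac_eq0 => /(_ b0).
by rewrite size_polyXn size_polyC tofrac_eq0 b0.
Qed.

(* [val_ge k g] says that the valuation of weight [w] is at least [k] at [g]. *)
Definition val_ge (k : nat) (g : K) : Prop :=
  exists n (a b : P), [/\ g = a%:F / b%:F, 'X^(n + k) %| phi a & exact_ord n b].

(* The fractions of weight-0 elements form a subfield on which the valuation is
   trivial. *)
Definition weight0 (g : K) : Prop :=
  exists a b : P, [/\ b != 0, g = a%:F / b%:F, phi a = (a%:F)%:P &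
    phi b = (b%:F)%:P].

Lemma val_geW k l g : (l <= k)%N -> val_ge k g -> val_ge l g.
Proof.
move=> le_lk [n [a [b [-> Xa Xb]]]]; exists n, a, b; split=> //.
by apply: dvdp_trans Xa; rewrite dvdp_exp2l // leq_add2l.
Qed.

Lemma exact_ord1 : exact_ord 0 1.
Proof. by apply: exact_ord_const; rewrite ?oner_eq0 // !rmorph1. Qed.

Lemma val_ge0 k : val_ge k 0.
Proof.
by exists 0%N, 0, 1; split; rewrite ?rmorph0 ?mul0r ?dvdp0 //; exact: exact_ord1.
Qed.

Lemma val_geN k g : val_ge k g -> val_ge k (- g).
Proof.
move=> [n [a [b [-> Xa Xb]]]]; exists n, (- a), b.
by rewrite !rmorphN mulNr dvdpNr.
Qed.

Lemma val_geD k g h : val_ge k g -> val_ge k h -> val_ge k (g + h).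
Proof.
move=> [n [a [b [-> Xa Xb]]]] [m [c [d [-> Xc Xd]]]].
exists (n + m)%N, (a * d + c * b), (b * d).
have b0 := exact_ord_neq0 Xb; have d0 := exact_ord_neq0 Xd; split.
- by rewrite rmorphD !rmorphM addf_div // tofrac_eq0.
- rewrite rmorphD !rmorphM dvdp_add //.
    by rewrite addnAC exprD dvdp_mul //; case: Xd.
  by rewrite -addnA addnC exprD dvdp_mul //; case: Xb.
- exact: exact_ordM.
Qed.

Lemma val_geM k l g h : val_ge k g -> val_ge l h -> val_ge (k + l) (g * h).
Proof.
move=> [n [a [b [-> Xa Xb]]]] [m [c [d [-> Xc Xd]]]].
exists (n + m)%N, (a * c), (b * d); split; last exact: exact_ordM.
  by rewrite !rmorphM invfM mulrACA.
by rewrite rmorphM addnACA exprD dvdp_mul.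
Qed.

Lemma val_geMl k g h : val_ge 0 g -> val_ge k h -> val_ge k (g * h).
Proof. exact: val_geM. Qed.

Lemma val_geMr k g h : val_ge k g -> val_ge 0 h -> val_ge k (g * h).
Proof. by move=> gk h0; rewrite mulrC; exact: val_geMl. Qed.

(** Valuation ring dichotomy, by comparing the orders of numerator and denominator. *)
Lemma val_geV g : g != 0 -> val_ge 0 g^-1 \/ val_ge 1 g.
Proof.
have [a [b [b0 ->]]] := fraction_ex g.
rewrite mulf_eq0 invr_eq0 !tofrac_eq0 (negPf b0) orbF => a0.
have [[m ea] [n eb]] := (exact_ord_ex a0, exact_ord_ex b0).
have [le_mn|lt_nm] := leqP m n.
  left; rewrite invf_div; exists m, b, a; split=> //.
  by rewrite addn0; case: eb => Xb _; apply: dvdp_trans Xb; rewrite dvdp_exp2l.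
right; exists n, a, b; split=> //.
by case: ea => Xa _; apply: dvdp_trans Xa; rewrite dvdp_exp2l // addn1.
Qed.

Lemma weight0_val_ge0 g : weight0 g -> val_ge 0 g.
Proof.
move=> [a [b [b0 -> phia phib]]]; exists 0%N, a, b; split=> //.
  by rewrite expr0 dvd1p.
exact: exact_ord_const.
Qed.

(** If a/b = c/d with a nonzero of weight 0, then a d = c b has exactly the order of d, while
    positive valuation makes the order of c larger. Elements of weight 0 are thus determined by
    their residues. *)
Lemma weight0_val_ge1 g : weight0 g -> val_ge 1 g -> g = 0.
Proof.
move=> [a [b [b0 -> phia phib]]] [n [c [d [/eqP]]]].
have [-> *|a0] := eqVneq a 0; first by rewrite rmorph0 mul0r.
move=> eq_ab Xc Xd; have d0 := exact_ord_neq0 Xd.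
move: eq_ab; rewrite eqr_div ?tofrac_eq0 // -!tofracM tofrac_eq => /eqP eq_ad.
have [_] := exact_ordM (exact_ord_const a0 phia) Xd.
by rewrite add0n eq_ad rmorphM dvdp_mulr // -addn1.
Qed.

Lemma weight01 : weight0 1.
Proof.
by exists 1, 1; rewrite oner_eq0 !rmorph1 divr1.
Qed.

Lemma weight0B g h : weight0 g -> weight0 h -> weight0 (g - h).
Proof.
move=> [a [b [b0 -> phia phib]]] [c [d [d0 -> phic phid]]].
exists (a * d - c * b), (b * d); split.
- by rewrite mulf_neq0.
- by rewrite -mulNr addf_div ?tofrac_eq0 // mulNr rmorphB !rmorphM.
- by rewrite !rmorphB !rmorphM /= phia phib phic phid ?polyCM.
- by rewrite !rmorphM /= phib phid ?polyCM.
Qed.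

Lemma weight0M g h : weight0 g -> weight0 h -> weight0 (g * h).
Proof.
move=> [a [b [b0 -> phia phib]]] [c [d [d0 -> phic phid]]].
exists (a * c), (b * d); split.
- by rewrite mulf_neq0.
- by rewrite !rmorphM invfM mulrACA.
- by rewrite !rmorphM /= phia phic ?polyCM.
- by rewrite !rmorphM /= phib phid ?polyCM.
Qed.

Lemma weight0V g : weight0 g -> weight0 g^-1.
Proof.
move=> [a [b [b0 -> phia phib]]]; rewrite invf_div.
have [->|a0] := eqVneq a 0; last by exists b, a.
by exists 0, 1; rewrite oner_eq0 rmorph0 invr0 mulr0 mul0r !rmorph0 !rmorph1.
Qed.

Lemma weight0U i : w i = 0%N -> weight0 (wvar P i)%:F.
Proof.
move=> wi; exists (wvar P i), 1; rewrite oner_eq0 !rmorph1 divr1.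
by rewrite wscale_var wi expr0 mulr1.
Qed.

Lemma val_ge1U i : w i = 1%N -> val_ge 1 (wvar P i)%:F.
Proof.
move=> wi; exists 0%N, (wvar P i), 1; rewrite rmorph1 divr1 wscale_var wi.
by split; [|rewrite dvdp_mull|exact: exact_ord1].
Qed.

End Valuation.

(** The valuation of h^n is at least n, and that of g = p/q is at most that of p, which is bounded
    by [N] uniformly in w. *)
Lemma val_ge_quot (I : Type) (P : weighted_domain I) (g : {fraction P}) : g != 0 ->
  exists N : nat, forall (w : I -> nat) (n : nat) h, (forall i, w i <= 1)%N ->
    (N < n)%N -> @val_ge I P w 1 h -> @val_ge I P w 1 (h ^+ n / g).
Proof.
have [p [q [q0 ->]]] := fraction_ex g.
rewrite mulf_eq0 invr_eq0 !tofrac_eq0 (negPf q0) orbF => p0.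
have [N pN] := wscale_Ndvd p0; exists N => w n h w_le1 lt_Nn.
move=> [l [a [b [-> Xa eb]]]].
have [k ep] := exact_ord_ex w p0.
have le_kN : (k <= N)%N.
  rewrite leqNgt; apply: contra (pN _ w_le1) => lt_Nk.
  by case: ep => Xp _; apply: dvdp_trans Xp; rewrite dvdp_exp2l.
have ebn : exact_ord w (l * n) (b ^+ n).
  elim: (n) => [|j IHj]; first by rewrite muln0 expr0; exact: exact_ord1.
  by rewrite mulnS exprS; exact: exact_ordM.
exists (l * n + k)%N, (a ^+ n * q), (b ^+ n * p); split; last exact: exact_ordM.
  by rewrite invf_div expr_div_n !rmorphM !rmorphXn invfM mulrACA [_^-1 * _]mulrC.
rewrite rmorphM rmorphXn dvdp_mulr //.
apply: dvdp_trans (dvdp_exp2r n Xa).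
by rewrite -exprM dvdp_exp2l // mulnDl mul1n -addnA leq_add2l addn1 (leq_ltn_trans le_kN).
Qed.

(** * The ring attached to a space *)

Section Spring.
Variables (X : Type) (I : choiceType) (U : I -> set X) (P : weighted_domain I).
Local Notation K := {fraction P}.

(** When the [U i] form a basis, this says that x lies in the closure of y. *)
Definition specializes (x y : X) : Prop := forall i, U i x -> U i y.

(* The variables t_i with x \notin U i are exactly those that vanish at x. *)
Definition wt (x : X) (i : I) : nat := ~~ `[<U i x>].

Lemma wt_le1 x i : (wt x i <= 1)%N.
Proof. exact: leq_b1. Qed.

Definition determined_by (T : Type) (s : seq I) (f : X -> T) : Prop :=
  forall x y, (forall i, i \in s -> U i x <-> U i y) -> f x = f y.

(* The last condition makes [f x] the residue of [f y] whenever x lies in the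
   closure of y. *)
Definition spring_fun (f : X -> K) : Prop :=
  [/\ exists s, determined_by s f,
      forall x, weight0 (wt x) (f x) &
      forall x y, specializes x y -> val_ge (wt x) 1 (f y - f x)].

Definition spring : {pred X -> K} := fun f => `[<spring_fun f>].

Lemma spring_val_ge0 f x y : spring_fun f -> specializes x y ->
  val_ge (wt x) 0 (f y).
Proof.
move=> [_ f0 fxy] le_xy; rewrite -[f y](subrK (f x)).
by apply: val_geD; [exact: val_geW (fxy _ _ le_xy)|exact: weight0_val_ge0].
Qed.

Fact spring_subring_closed : subring_closed spring.
Proof.
split.
- apply/asboolP; split; first by exists [::].
    by move=> x; exact: weight01.
  by move=> x y _; rewrite subrr; exact: val_ge0.
- move=> f g /asboolP[[s fs] f0 fxy] /asboolP[[t gt] g0 gxy].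
  apply/asboolP; split.
  + exists (s ++ t) => x y eq_xy; congr (_ - _).
      by apply: fs => i si; apply: eq_xy; rewrite mem_cat si.
    by apply: gt => i ti; apply: eq_xy; rewrite mem_cat ti orbT.
  + by move=> x; exact: weight0B.
  + move=> x y le_xy; rewrite [X in val_ge _ _ X](_ : _ = (f y - f x) - (g y - g x)).
      by apply: val_geD; [exact: fxy|apply: val_geN; exact: gxy].
    change (f y - g y - (f x - g x) = (f y - f x) - (g y - g x)).
    by rewrite !opprB addrACA [RHS]addrACA [- g y - _]addrC.
- move=> f g Af Ag.
  have [/asboolP Sf /asboolP Sg] := (Af, Ag).
  case/asboolP: Af => [[s fs] f0 fxy]; case/asboolP: Ag => [[t gt] g0 gxy].
  apply/asboolP; split.
  + exists (s ++ t) => x y eq_xy; congr (_ * _).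
      by apply: fs => i si; apply: eq_xy; rewrite mem_cat si.
    by apply: gt => i ti; apply: eq_xy; rewrite mem_cat ti orbT.
  + by move=> x; exact: weight0M.
  + move=> x y le_xy.
    rewrite [X in val_ge _ _ X](_ : _ = (f y - f x) * g y + f x * (g y - g x)).
      apply: val_geD; first by apply: val_geMr (fxy _ _ le_xy) (spring_val_ge0 Sg le_xy).
      by apply: val_geMl (gxy _ _ le_xy); exact: weight0_val_ge0.
    by rewrite mulrBl mulrBr addrA subrK.
Qed.

Record spring_ring := SpringRing { spring_val :> X -> K; _ : spring_val \in spring }.

HB.instance Definition _ := [isSub for spring_val].
HB.instance Definition _ := [Choice of spring_ring by <:].
HB.instance Definition _ := GRing.SubChoice_isSubComPzRing.Build
  (X -> K) spring spring_ring spring_subring_closed.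

Lemma spring_ringP (f : spring_ring) : spring_fun f.
Proof. by apply/asboolP; exact: (valP f). Qed.

Lemma spring_ring_eq (f g : spring_ring) : (forall x, f x = g x) -> f = g.
Proof. by move=> fg; apply/val_inj/funext. Qed.

(** If f y = 0, then f x has positive valuation at x and weight 0, so it vanishes. *)
Lemma spring_specializes (f : spring_ring) x y :
  specializes x y -> f x != 0 -> f y != 0.
Proof.
have [_ f0 fxy] := spring_ringP f => le_xy; apply: contraNneq => fy0.
have := fxy _ _ le_xy; rewrite fy0 sub0r => /val_geN; rewrite opprK.
by move=> /(weight0_val_ge1 (f0 x)) ->.
Qed.

Definition coord_fun (i : I) (x : X) : K :=
  if `[<U i x>] then (wvar P i)%:F else 0.

Fact coord_fun_spring i : coord_fun i \in spring.
Proof.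
apply/asboolP; split.
- exists [:: i] => x y /(_ i (mem_head _ _)) eq_xy.
  by rewrite /coord_fun (asbool_equiv_eq eq_xy).
- move=> x; rewrite /coord_fun; case: asboolP => Uix.
    by apply: weight0U; rewrite /wt asboolT.
  by rewrite -(subrr 1); apply: weight0B; exact: weight01.
- move=> x y le_xy; rewrite /coord_fun.
  have [Uix|nUix] := pselect (U i x).
    by rewrite !asboolT ?subrr //; [exact: val_ge0|exact: le_xy].
  rewrite [in X in _ - X]asboolF // subr0; case: asboolP => _; last exact: val_ge0.
  by apply: val_ge1U; rewrite /wt asboolF.
Qed.

Definition spring_coord i : spring_ring := SpringRing (coord_fun_spring i).

Lemma spring_coord_neq0 i x : (spring_coord i x != 0) = `[<U i x>].
Proof.
rewrite /= /coord_fun; case: asboolP; rewrite ?eqxx // => _.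
by rewrite tofrac_eq0 wvar_neq0.
Qed.

(** The value at x depends only on the pattern of memberships of x in the [U i], i in s, and there
    are finitely many patterns. *)
Lemma determined_finite (T : eqType) (s : seq I) (f : X -> T) :
  determined_by s f -> exists l : seq T, forall x, f x \in l.
Proof.
move=> fs.
pose pat x : {ffun seq_sub s -> bool} := [ffun i => `[<U (val i) x>]].
have [[x0 _]|noX] := pselect (exists x : X, True); last first.
  by exists [::] => x; case: noX; exists x.
(* [x0] is a default for patterns that no point realizes. *)
pose rep p := if pselect (exists x, pat x = p) is left e then projT1 (cid e) else x0.
exists [seq f (rep p) | p <- enum {ffun seq_sub s -> bool}] => x.
apply/mapP; exists (pat x); rewrite ?mem_enum //; apply: fs => i si.
rewrite /rep; case: pselect => [e|]; last by case; exists x.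
case: (cid e) => y /= /ffunP/(_ (SeqSub si)); rewrite !ffunE /= => eq_xy.
by split=> /asboolP; [rewrite -eq_xy|rewrite eq_xy] => /asboolP.
Qed.

(** [N] is the maximum of the bounds of [val_ge_quot] over the finitely many nonzero values of g. *)
Lemma spring_bound (g : spring_ring) : exists N : nat,
  forall x y n h, g y != 0 -> (N < n)%N -> val_ge (wt x) 1 h ->
    val_ge (wt x) 1 (h ^+ n / g y).
Proof.
have [[s gs] _ _] := spring_ringP g.
have [l gl] := determined_finite gs.
suff [N Nl] : exists N : nat, forall k, k \in l -> k != 0 ->
    forall x n h, (N < n)%N -> val_ge (wt x) 1 h -> val_ge (wt x) 1 (h ^+ n / k).
  by exists N => x y n h gy; exact: Nl.
elim: (l) => [|k l' [N Nl']]; first by exists 0%N.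
have [k0|k0] := eqVneq k 0.
  exists N => k'; rewrite inE => /predU1P[->|]; last exact: Nl'.
  by rewrite k0 eqxx.
have [M Mk] := val_ge_quot k0.
exists (maxn M N) => k'; rewrite inE => k'l k'0 x n h.
rewrite gtn_max => /andP[ltM ltN] h1.
case/predU1P: k'l => [->|k'l]; last exact: Nl'.
by apply: Mk => // i; exact: wt_le1.
Qed.

Lemma spring_ringX (a : spring_ring) n x : (a ^+ n) x = a x ^+ n.
Proof. by elim: n => [|n IHn]; rewrite ?expr0 // !exprS -IHn. Qed.

Lemma spring_rad (a b : spring_ring) :
  (forall x, a x != 0 -> b x != 0) -> exists n c, a ^+ n = c * b.
Proof.
move=> ab; have [N Nb] := spring_bound b; pose n := N.+1.
have [_ an0 anxy] := spring_ringP (a ^+ n).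
have [[s as_] a0 axy] := spring_ringP a.
have [[t bt] b0 bxy] := spring_ringP b.
(* Since inverting 0 gives 0, this quotient is already extended by 0 outside D(b). *)
have c_spring : (fun x => a x ^+ n / b x) \in spring.
  apply/asboolP; split.
  - exists (s ++ t) => x y eq_xy; congr (_ ^+ _ / _).
      by apply: as_ => i si; apply: eq_xy; rewrite mem_cat si.
    by apply: bt => i ti; apply: eq_xy; rewrite mem_cat ti orbT.
  - by move=> x; apply: weight0M; [rewrite -spring_ringX|exact/weight0V].
  - move=> x y le_xy.
    (* If b x = 0, then a x = 0, so a y has positive valuation at x and its n-th power absorbs the
       division by b y. *)
    have [bx|bx] := eqVneq (b x) 0.
      have ax : a x = 0 by apply/eqP; apply: contraTT isT => /ab; rewrite bx eqxx.
      rewrite bx invr0 mulr0 subr0; have [->|by0] := eqVneq (b y) 0.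
        by rewrite invr0 mulr0; exact: val_ge0.
      by apply: Nb => //; rewrite -[a y]subr0 -ax; exact: axy.
    have by0 := spring_specializes le_xy bx.
    (* Otherwise b y, and with it b x, would have positive valuation, forcing b x = 0. *)
    have uby : val_ge (wt x) 0 (b y)^-1.
      have [//|by1] := val_geV (wt x) by0; case/negP: bx; apply/eqP.
      apply: (weight0_val_ge1 (b0 x)); rewrite -[b x](subKr (b y)).
      by apply: val_geD by1 _; apply: val_geN; exact: bxy.
    rewrite [X in val_ge _ _ X](_ : _ =
      ((a y ^+ n - a x ^+ n) - a x ^+ n / b x * (b y - b x)) / b y).
      apply: val_geMr uby; apply: val_geD.
        by have := anxy _ _ le_xy; rewrite !spring_ringX.
      apply/val_geN/val_geMl; last exact: bxy.
      apply: (@val_geM _ _ _ 0 0); apply: weight0_val_ge0; first by rewrite -spring_ringX.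
      exact: weight0V.
    rewrite mulrBr divfK // opprB addrA subrK mulrBl.
    by rewrite -[_ * b y / b y]mulrA divff // mulr1.
exists n, (SpringRing c_spring); apply: spring_ring_eq => x.
rewrite spring_ringX; change (a x ^+ n = a x ^+ n / b x * b x).
have [bx|bx] := eqVneq (b x) 0; last by rewrite divfK.
rewrite bx mulr0; apply/eqP; rewrite expf_eq0 /=.
by apply: contraTT isT => /ab; rewrite bx eqxx.
Qed.

Lemma natr_frac_inj : injective (fun n => n%:R : K).
Proof.
have natr_eq0 (n : nat) : (n%:R == 0 :> K) = (n == 0)%N.
  case: n => [|n]; first by rewrite !eqxx.
  by rewrite -(rmorph_nat (@FracField.tofrac P)) tofrac_eq0 (negPf (wdom_natr_neq0 P n)).
suff le_inj m n : (m <= n)%N -> m%:R = n%:R :> K -> m = n.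
  by move=> m n mn; have [le_mn|/ltnW le_nm] := leqP m n; [|symmetry]; apply: le_inj.
move=> le_mn /eqP; rewrite eq_sym -subr_eq0 -natrB // natr_eq0 subn_eq0 => le_nm.
by apply/eqP; rewrite eqn_leq le_mn.
Qed.

Lemma spring_union (b c : spring_ring) : exists n : nat,
  forall x, (b x != 0) || (c x != 0) -> b x + n%:R * c x != 0.
Proof.
have [[[s bs] _ _] [[t ct] _ _]] := (spring_ringP b, spring_ringP c).
(* Where c x is nonzero, b x + n c x vanishes only for n = - b x / c x. So n is chosen outside the
   finite list of these values, by pigeonhole among [(size l).+1] distinct integers. *)
have [l lP] : exists l : seq K, forall x, - (b x / c x) \in l.
  apply: (@determined_finite _ (s ++ t)) => x y eq_xy; congr (- (_ / _)).
    by apply: bs => i si; apply: eq_xy; rewrite mem_cat si.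
  by apply: ct => i ti; apply: eq_xy; rewrite mem_cat ti orbT.
have [n nl] : exists n : nat, n%:R \notin l.
  pose ns := [seq n%:R : K | n <- iota 0 (size l).+1].
  have ns_uniq : uniq ns by rewrite map_inj_uniq ?iota_uniq //; exact: natr_frac_inj.
  have [/allP nsl|/allPn[_ /mapP[n _ ->] nl]] := boolP (all (mem l) ns); last by exists n.
  by have := uniq_leq_size ns_uniq nsl; rewrite size_map size_iota ltnn.
exists n => x; have [->|cx _] := eqVneq (c x) 0.
  by rewrite orbF mulr0 addr0.
apply: contra nl => /eqP bc0; suff -> : n%:R = - (b x / c x) by exact: lP.
apply: (mulIf cx); rewrite mulNr divfK //.
by apply/eqP; rewrite -addr_eq0 addrC bc0.
Qed.

End Spring.

(** * Prime ideals are points: the homeomorphism with the spectrum *)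

Section Hochster.
Variables (X : topologicalType) (I : choiceType) (U : I -> set X).
Hypothesis U_cover : forall x, exists i, U i x.
Hypothesis U_inter : forall i j, exists k, U k = U i `&` U j.
Hypothesis U_open : forall O : set X,
  open O <-> forall x, O x -> exists2 i, U i x & U i `<=` O.
Hypothesis U_T0 : forall x y, (forall i, U i x <-> U i y) -> x = y.
Hypothesis U_ultra : forall UU : set_system X, UltraFilter UU ->
  exists x, forall i, U i x <-> UU (U i).
Variable P : weighted_domain I.
Local Notation R := (spring_ring U P).

(** f depends on finitely many memberships, and each of them agrees with that of the limit x on a
    set of [UU]. *)
Lemma spring_ultra_eq (UU : set_system X) (x : X) (f : R) :
  UltraFilter UU -> (forall i, U i x <-> UU (U i)) ->
  UU [set y | f y = f x].
Proof.
move=> UUu xUU; have [[s fs] _ _] := spring_ringP f.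
suff : UU [set y | forall i, i \in s -> U i y <-> U i x].
  by apply: filterS => y; exact: fs.
elim: (s) => [|i t IHt]; first by apply: filterS filterT.
have UUi : UU [set y | U i y <-> U i x].
  have [Uix|nUix] := pselect (U i x).
    by move/xUU: (Uix); apply: filterS.
  have [/xUU//|] := in_ultra_setVsetC (U i) UUu.
  by apply: filterS => y nUiy; split=> // /nUiy.
apply: filterS (filterI UUi IHt) => y [iy ty] j.
by rewrite inE => /predU1P[->|] //; exact: ty.
Qed.

(** If no [U i] around x lies in D(f), the sets [U i] minus D(f) generate a proper filter. An
    ultrafilter above it has a limit z that specializes to x and satisfies f z = 0, against
    [spring_specializes]. *)
Lemma spring_open (f : R) : open [set x | f x != 0].
Proof.
apply/U_open => x fx; apply: contrapT => noi.
pose F := filter_from [set i | U i x] (fun i => U i `&` [set y | f y = 0]).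
have FF : ProperFilter F.
  apply: filter_from_proper; first apply: filter_from_filter.
  - exact: U_cover.
  - move=> i j Uix Ujx; have [k Uk] := U_inter i j.
    by exists k; rewrite /= Uk // => y [[Uiy Ujy] fy].
  - move=> i Uix; apply: contrapT => noy; apply: noi; exists i => // y Uiy.
    by apply/eqP => fy; apply: noy; exists y.
have [UU [UUu FUU]] := ultraFilterLemma FF.
have [z zUU] := U_ultra UUu.
have le_xz : specializes U x z.
  by move=> i Uix; apply/zUU/FUU; exists i => // y [].
have /eqP[] := spring_specializes le_xz fx.
have UUz : UU [set y | f y = 0].
  by apply: FUU; have [i Uix] := U_cover x; exists i => // y [].
have [y [/= <- //]] := filter_ex (filterI (spring_ultra_eq f UUu zUU) UUz).
Qed.

Definition point_ideal (x : X) : set R := [set f | f x = 0].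

Fact point_ideal_prime x : prime_ideal (point_ideal x).
Proof.
split=> //=.
- move=> f g; rewrite /point_ideal /= => fx gx.
  by change (f x + g x = 0); rewrite fx gx addr0.
- move=> f g; rewrite /point_ideal /= => gx.
  by change (f x * g x = 0); rewrite gx mulr0.
- rewrite /point_ideal /=; change ((1 : {fraction P}) <> 0).
  by apply/eqP; rewrite oner_eq0.
- move=> f g; rewrite /point_ideal /=.
  change (f x * g x = 0 -> f x = 0 \/ g x = 0).
  by move/eqP; rewrite mulf_eq0 => /orP[]/eqP; [left|right].
Qed.

Definition point_spec (x : X) : Spec R :=
  exist _ (point_ideal x) (mem_set (point_ideal_prime x)).

Lemma prime_is_point (p : set R) : prime_ideal p -> exists x, p = point_ideal x.
Proof.
move=> [p0 pD pM p1 pP].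
pose D := [set ab : R * R | ~ p ab.1 /\ p ab.2].
pose B (ab : R * R) := [set x : X | ab.1 x != 0 /\ ab.2 x = 0].
have pX n a : p (a ^+ n) -> p a.
  by elim: n => [|n IHn]; rewrite ?expr0 // exprS => /pP[].
have FF : ProperFilter (filter_from D B).
  apply: filter_from_proper; first apply: filter_from_filter.
  - by exists (1, 0).
  - move=> [a b] [c d] [/= pa pb] [/= pc pd].
    (* D(ac) minus D(b + n d) is contained in both given sets, and ac is not in p by primality. *)
    have [n bdn] := spring_union b d.
    exists (a * c, b + n%:R * d); first split=> /=.
    + by case/pP.
    + by apply: pD => //; exact: pM.
    have nE x : (n%:R : R) x = n%:R.
      by elim: n {bdn} => // n IHn; rewrite !mulrS -IHn.
    move=> x; rewrite /B /= => -[].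
    change (a x * c x != 0 -> b x + (n%:R : R) x * d x = 0 ->
      (a x != 0 /\ b x = 0) /\ (c x != 0 /\ d x = 0)).
    rewrite nE mulf_eq0 negb_or => /andP[ax cx] bd0.
    have := bdn x; rewrite bd0 eqxx; case: eqVneq => [->|_ /(_ isT)//].
    by case: eqVneq => [->|_ /(_ isT)//].
  (* An empty D(a) minus D(b) would make b divide a power of a, putting a in p. *)
  - move=> [a b] [/= pa pb]; apply: contrapT => noB; apply: pa.
    have [|n [c abc]] := @spring_rad _ _ _ _ a b.
      by move=> x ax; apply/eqP => bx; apply: noB; exists x.
    by apply: (pX n); rewrite abc; exact: pM.
have [UU [UUu FUU]] := ultraFilterLemma FF.
have [x xUU] := U_ultra UUu; exists x.
(* The pair (1, f) serves when f is in p, and (f, 0) when it is not. *)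
apply/seteqP; split=> f.
  move=> pf; have UUf : UU [set y | f y = 0].
    by apply: FUU; exists (1, f) => // y [].
  have [y [fy fy0]] := filter_ex (filterI (spring_ultra_eq f UUu xUU) UUf).
  exact: etrans (esym fy) fy0.
move=> fx; apply: contrapT => npf.
have UUf : UU [set y | f y != 0] by apply: FUU; exists (f, 0) => // y [].
have [y [fy /eqP]] := filter_ex (filterI (spring_ultra_eq f UUu xUU) UUf).
by case; exact: etrans fy fx.
Qed.

Lemma coord_zero x i : (spring_coord U P i) x = 0 <-> ~ U i x.
Proof.
have H := spring_coord_neq0 U P i x; split=> [c0 Uix|nUix].
  by move: H; rewrite c0 eqxx asboolT.
by apply/eqP; move: H; rewrite asboolF // => /negbFE.
Qed.

Theorem homeomorphic_Spec_spring : homeomorphic X (Spec R).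
Proof.
have pt_ex (p : Spec R) : exists x, p = point_spec x.
  have [x px] := prime_is_point (Spec_prime p).
  by exists x; apply: val_inj.
pose pt p := projT1 (cid (pt_ex p)).
have ptK : cancel pt point_spec by move=> p; rewrite /pt; case: (cid _).
exists point_spec, pt; split=> //.
- apply/continuousP => O [S ->]; apply/U_open => x /zero_locusCE[f Sf /eqP fx].
  have /U_open/(_ x fx)[i Uix Uif] := spring_open f.
  exists i => // y /Uif fy; apply/zero_locusCE; exists f => //; exact/eqP.
(* O is the union of the [U i] inside it, and [U i] is D of the i-th coordinate. *)
- apply/continuousP => O Oop; exists [set spring_coord U P i | i in [set i | U i `<=` O]].
  rewrite predeqE => p; rewrite -[p in X in _ <-> X]ptK; split.
    move=> Op; apply/zero_locusCE.
    have /U_open/(_ _ Op)[i Uip UiO] := Oop.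
    by exists (spring_coord U P i); [exists i|move/coord_zero].
  by move=> /zero_locusCE[_ [i UiO <-]] /coord_zero/contrapT; exact: UiO.
- move=> x; apply: U_T0 => i.
  have /seteqP[le1 le2] := congr1 val (ptK (point_spec x)).
  have iP y : U i y <-> ~ (val (point_spec y) : set R) (spring_coord U P i).
    by split=> [Uiy /coord_zero|/coord_zero/contrapT].
  by rewrite !iP; split=> nc c; apply: nc; [exact: le2|exact: le1].
Qed.

End Hochster.

(** * Subcategories of an extriangulated category *)

Section Extriangulated.
Variable E : extriangulated_category.

Lemma direct_sum_zero (A Z : E) : is_zero_object Z -> is_direct_sum A Z A.
Proof.
move=> [toZ fromZ]; exists (idm A), 0, (idm A), 0; split.
- exact: comp1m.
- by rewrite [LHS]toZ [RHS]toZ.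
- exact: fromZ.
- exact: toZ.
- rewrite comp1m (_ : Defs.comp _ _ = 0) ?addr0 //.
  by apply: (addrI (Defs.comp 0 (0 : Defs.hom A Z))); rewrite -compDl !addr0.
Qed.

Lemma as_zero (P : set E) (Z : E) : as_subcat E P -> is_zero_object Z -> P Z.
Proof.
move=> [[A PA] _ smdP] /direct_sum_zero sumAZ.
by have [] := smdP _ _ _ (sumAZ A) PA.
Qed.

Section Esp.
Variables (C : set (set E)) (hC : C `<=` as_subcat E).

Lemma UC_direct_sum (A B S : E) : is_direct_sum A B S ->
  UC [set S] = UC [set A] `&` UC [set B] :> set (Esp hC).
Proof.
move=> sumS; rewrite predeqE => P; have [_ sumP smdP] := Esp_as P.
rewrite /setI /= !UC1E; split=> [/(smdP _ _ _ sumS)|[]] //.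
exact: sumP sumS.
Qed.

(** Each point contains the zero objects; closure under sums comes from intersecting two members of
    [UU], and closure under summands from enlarging one. *)
Lemma ultra_as (UU : set_system (Esp hC)) : UltraFilter UU ->
  as_subcat E [set A : E | UU (UC [set A])].
Proof.
move=> UUu; split.
- have [Z Z0] := has_zero_object E; exists Z; apply: filterS filterT => P _.
  by apply/UC1E; apply: as_zero Z0; exact: Esp_as.
- by move=> A B S sumS; rewrite /= (UC_direct_sum sumS); exact: filterI.
- move=> A B S sumS; rewrite /= (UC_direct_sum sumS) => UUAB.
  by split; apply: filterS UUAB => P [].
Qed.

Lemma spectral_Esp :
  (forall UU : set_system (Esp hC), UltraFilter UU ->
     C [set A : E | UU (UC [set A])]) ->
  spectral (Esp hC).
Proof.
move=> ultraC.
(* [{classic E}] provides the choice structure needed to index variables by objects. *)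
pose U : {classic E} -> set (Esp hC) := fun A => UC [set (A : E)].
exists (spring_ring U (ratpoly_wdom _)).
apply: homeomorphic_Spec_spring.
- by move=> P; have [[A PA] _ _] := Esp_as P; exists A; apply/UC1E.
- move=> A B; have [S sumS] := has_direct_sums (A : E) B.
  by exists S; exact: UC_direct_sum.
- move=> O; split=> [[Y ->] P /UCE[A [PA YA]]|Oop].
    exists A; first exact/UC1E.
    by move=> Q /UC1E QA; apply/UCE; exists A.
  exists [set A | UC [set A] `<=` O]; rewrite predeqE => P; split.
    by move=> /Oop[A /UC1E PA AO]; apply/UCE; exists A.
  by move=> /UCE[A [PA AO]]; apply/AO/UC1E.
- move=> P Q PQ; apply: val_inj; apply/seteqP.
  by split=> A /UC1E/PQ/UC1E.
(* The limit of [UU] is the subcategory that it defines, a point by hypothesis. *)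
- move=> UU UUu; pose L : Esp hC :=
    exist (fun P => P \in C) _ (mem_set (ultraC UU UUu)).
  by exists L => A; exact: (UC1E A L).
Qed.

End Esp.

(** Each 2-out-of-3 implication has two premises, so it passes from the points to [UU] through the
    intersection of two members. *)
Lemma ultra_thick (UU : set_system (Esp (@thick_as E))) : UltraFilter UU ->
  thick_subcat E [set A : E | UU (UC [set A])].
Proof.
move=> UUu; split; first exact: ultra_as.
move=> L M N x y xy.
have P23 (P : Esp (@thick_as E)) := (set_valP P).2 _ _ _ _ _ xy.
split=> /= UU1 UU2; apply: filterS (filterI UU1 UU2) => P;
by have [] := P23 P; rewrite /setI /= !UC1E => h1 h2 h3 []; auto.
Qed.

End Extriangulated.

Theorem corollary4p7 (E : extriangulated_category) :
  (forall (C : set (set E)) (hC : C `<=` as_subcat E),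
     (forall UU : set_system (Esp hC), UltraFilter UU ->
        C [set A : E | UU (UC [set A])]) ->
     spectral (Esp hC)) /\
  spectral (Esp (@subset_refl (set E) (as_subcat E))) /\
  spectral (Esp (@thick_as E)).
Proof.
split; first exact: spectral_Esp.
by split; apply: spectral_Esp => UU UUu; [exact: ultra_as|exact: ultra_thick].
Qed.
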